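(* Let $n\ge1$ and $a=(t,t^{-1})\in A$ with $t=\mathrm{diag}(t_1,\dots,t_{n+1})$, $t_1\cdots t_{n+1}=1$. The first row of $g_a\in\mathrm{End}(\mathbb{C}^{n+1})$ is given as follows: for $m=1,\dots,n+1$ the $m$-th element is $$(t_1,\dots,t_{n+1})\mapsto\binom{n}{m-1}^{-1}\sum_{(J,K)\in\mathcal{J}_m\times\mathcal{J}_{n+2-m}:\ J\cap K=\{1\}}\frac{t^J}{t^K},$$ where $t^J=t_{j_1}\cdots t_{j_m}$ and $t^K=t_{k_1}\cdots t_{k_{n+2-m}}$.
   Context: $\mathcal{J}_i$ is the set of $i$-tuples $1\le j_1<\cdots<j_i\le n+1$, regarded as subsets of $\{1,\dots,n+1\}$. $G=\mathrm{SL}(n+1,\mathbb{C})\times\mathrm{SL}(n+1,\mathbb{C})$, $H$ is the diagonal subgroup, $A=\{(t,t^{-1})\mid t\text{ diagonal in }\mathrm{SL}(n+1,\mathbb{C})\}$. $V=\mathbb{C}^{n+1}$ has standard orthonormal basis $e_1,\dots,e_{n+1}$. For $m=1,\dots,n+1$ the irreducible $G$-module $V_m=\bigwedge^mV\otimes\bigwedge^{n+2-m}V$ (first factor of $G$ acting on the first tensor factor, second on the second), with its standard $\mathrm{SU}(n+1)\times\mathrm{SU}(n+1)$-invariant inner product, contains $V$ exactly once on restriction to $H$; let $j_m:V\to V_m$ be an isometric $H$-equivariant embedding and $p_m=j_m^*$. For $a\in A$ the operator $p_m\circ a\circ j_m$ on $V$ is diagonal in the basis $(e_i)$, and $(g_a)_{i,m}$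 is defined as the scalar by which it acts on $e_i$ (so $g_a$ is the matrix $\Phi^{\omega_1}_0(a)$ of restricted minimal spherical functions of type $V$). *)

(* Defs.v *)
From HB Require Import structures.
From mathcomp Require Import all_boot all_order all_algebra all_fingroup.
From mathcomp Require Export complex reals.
Set Implicit Arguments.
Unset Strict Implicit.
Unset Printing Implicit Defensive.
Import Order.TTheory GRing.Theory Num.Theory.
Local Open Scope ring_scope.

(* Conventions.  V = C^N is 'cV[C]_N, with basis vectors delta_mx i 0; all
   indices are shifted down by one, so i : 'I_N starts at 0.  As C has characteristic 0, the
   exterior power \bigwedge^a V is realised as the space of alternating tensors
   in V^{\otimes a}, a tensor being given by its coordinates on the basis
   e_{f 0} \otimes ... \otimes e_{f (a-1)}, f : 'I_a -> 'I_N.  Accordingly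
   \bigwedge^a V \otimes \bigwedge^b V is the space of tensors in
   V^{\otimes a} \otimes V^{\otimes b} that are alternating in the first a
   factors and alternating in the last b factors. *)

Section ExteriorPair.
Variables (C : numClosedFieldType) (N : nat).
Implicit Types (a b : nat).

Local Notation index a b := ({ffun 'I_a -> 'I_N} * {ffun 'I_b -> 'I_N})%type.
Local Notation tensor a b := {ffun index a b -> C^o}.

Definition fcomp (I : finType) (f : {ffun I -> 'I_N}) (s : {perm I}) :
    {ffun I -> 'I_N} := [ffun x => f (s x)].

Definition bialternating a b : {pred tensor a b} := fun T =>
  [forall s : 'S_a, forall r : 'S_b, forall f, forall h,
     T (fcomp f s, fcomp h r) == (-1) ^+ s * (-1) ^+ r * T (f, h)].
Arguments bialternating : clear implicits.

Lemma bialternatingP a b (T : tensor a b) :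
  reflect (forall s r f h, T (fcomp f s, fcomp h r)
                           = (-1) ^+ odd_perm s * (-1) ^+ odd_perm r * T (f, h))
          (T \in bialternating a b).
Proof.
apply: (iffP forallP) => [H s r f h | H s].
  by move/forallP: (H s) => /(_ r) /forallP /(_ f) /forallP /(_ h) /eqP.
by apply/forallP=> r; apply/forallP=> f; apply/forallP=> h; rewrite H.
Qed.

Lemma bialternating_submod a b : submod_closed (bialternating a b).
Proof.
split=> [|c u v /bialternatingP Hu /bialternatingP Hv]; apply/bialternatingP.
  by move=> s r f h; rewrite !ffunE mulr0.
move=> s r f h; rewrite !ffunE Hu Hv mulrDr; congr (_ + _).
exact: mulrCA.
Qed.

HB.instance Definition _ a b :=
  GRing.isSubmodClosed.Build C (tensor a b) (bialternating a b)
    (bialternating_submod a b).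

Record ext_pair a b := ExtPair {
  ext_val :> tensor a b;
  ext_valP : ext_val \in bialternating a b
}.

HB.instance Definition _ a b := [isSub for @ext_val a b].
HB.instance Definition _ a b := [Choice of ext_pair a b by <:].
HB.instance Definition _ a b := [SubChoice_isSubLmodule of ext_pair a b by <:].

(* g.1^{\otimes a} \otimes g.2^{\otimes b} in coordinates. *)
Definition tensor_act a b (g : 'M[C]_N * 'M[C]_N) (T : tensor a b) :
    tensor a b :=
  [ffun fh : index a b => \sum_(fh' : index a b)
     (\prod_(x < a) g.1 (fh.1 x) (fh'.1 x)) *
     (\prod_(y < b) g.2 (fh.2 y) (fh'.2 y)) * T fh'].

Lemma fcompK (I : finType) (s : {perm I}) :
  cancel (fun f => fcomp f s) (fun f => fcomp f s^-1%g).
Proof. by move=> f; apply/ffunP=> x; rewrite !ffunE permKV. Qed.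

Lemma prod_fcomp (I : finType) (M : 'M[C]_N) (f h : {ffun I -> 'I_N})
    (s : {perm I}) :
  \prod_x M (fcomp f s x) (fcomp h s x) = \prod_x M (f x) (h x).
Proof.
rewrite [RHS](reindex_inj (@perm_inj _ s)) /=.
by apply: eq_bigr => x _; rewrite !ffunE.
Qed.

Lemma tensor_act_alt a b g (T : ext_pair a b) :
  tensor_act g T \in bialternating a b.
Proof.
case: T => T /= /bialternatingP HT; apply/bialternatingP => s r f h.
rewrite !ffunE /= mulr_sumr.
rewrite (reindex_inj (h := fun p => (fcomp p.1 s, fcomp p.2 r))) /=; last first.
  by move=> [p1 p2] [q1 q2] [/(can_inj (fcompK s)) -> /(can_inj (fcompK r)) ->].
apply: eq_bigr => -[p1 p2] _ /=.
by rewrite !prod_fcomp HT mulrCA.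
Qed.

Definition act a b (g : 'M[C]_N * 'M[C]_N) (T : ext_pair a b) : ext_pair a b :=
  ExtPair (tensor_act_alt g T).

Definition dotV (v w : 'cV[C]_N) : C := \sum_i v i 0 * (w i 0)^*.

(* The factor makes the vectors
   (e_{j_1} /\ ... /\ e_{j_a}) \otimes (e_{k_1} /\ ... /\ e_{k_b})
   orthonormal, where v_1 /\ ... /\ v_a = \sum_s sgn(s) v_{s 1} \otimes ... *)
Definition dotE a b (T U : ext_pair a b) : C :=
  (a`! * b`!)%:R^-1 * \sum_fh T fh * (U fh)^*.

Definition SL : {pred 'M[C]_N} := [pred g | \det g == 1].

Definition isometric a b (j : 'cV[C]_N -> ext_pair a b) : Prop :=
  forall v w, dotE (j v) (j w) = dotV v w.

Definition H_equivariant a b (j : 'cV[C]_N -> ext_pair a b) : Prop :=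
  forall h, h \in SL -> forall v, j (h *m v) = act (h, h) (j v).

Definition adjoint a b (j : 'cV[C]_N -> ext_pair a b)
    (p : ext_pair a b -> 'cV[C]_N) : Prop :=
  forall T v, dotV (p T) v = dotE T (j v).

(* The element (t, t^-1) of A. *)
Definition Aelt (t : 'rV[C]_N) : 'M[C]_N * 'M[C]_N :=
  (diag_mx t, invmx (diag_mx t)).

End ExteriorPair.

Arguments SL {C N}.

(* \bigwedge^{m'} V \otimes \bigwedge^{n+2-m'} V, where m' = m + 1 runs over
   1, ..., n+1. *)
Definition Vmod (C : numClosedFieldType) (n : nat) (m : 'I_n.+1) :=
  ext_pair C n.+1 m.+1 (n.+2 - m.+1).

(* The diagonal entries in the basis (e_i) of the operators p_m a j_m; by
   [gmatP] below these are the scalars by which the operators act on e_i. *)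
Definition gmat (C : numClosedFieldType) (n : nat)
    (j : forall m : 'I_n.+1, 'cV[C]_n.+1 -> Vmod C m)
    (p : forall m : 'I_n.+1, Vmod C m -> 'cV[C]_n.+1)
    (a : 'M[C]_n.+1 * 'M[C]_n.+1) : 'M[C]_n.+1 :=
  \matrix_(i, m) (p m (act a (j m (delta_mx i 0)))) i 0.

Lemma dotV_delta (C : numClosedFieldType) N (v : 'cV[C]_N) k :
  dotV v (delta_mx k 0) = v k 0.
Proof.
rewrite /dotV (bigD1 k) //= mxE !eqxx rmorph1 mulr1 big1 ?addr0 // => i ik.
by rewrite mxE (negPf ik) rmorph0 mulr0.
Qed.

Lemma prod_diag (C : numClosedFieldType) N (d : 'rV[C]_N) (I : finType)
    (f h : {ffun I -> 'I_N}) :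
  \prod_x diag_mx d (f x) (h x) = (\prod_x d 0 (f x)) *+ (f == h).
Proof.
case: (eqVneq f h) => [->|fh].
  by rewrite mulr1n; apply: eq_bigr => x _; rewrite mxE eqxx.
have [x fx] : exists x, f x != h x.
  by apply/existsP; rewrite -negb_forall; apply: contraNN fh => /forallP E;
    apply/eqP/ffunP=> x; apply/eqP.
by rewrite (bigD1 x) //= mxE (negPf fx) mul0r.
Qed.

Lemma act_diag (C : numClosedFieldType) N a b (c d : 'rV[C]_N)
    (T : ext_pair C N a b) f h :
  act (diag_mx c, diag_mx d) T (f, h) =
  (\prod_x c 0 (f x)) * (\prod_y d 0 (h y)) * T (f, h).
Proof.
rewrite ffunE (bigD1 (f, h)) //= !prod_diag !eqxx [X in _ + X]big1 ?addr0 // => -[f' h'].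
rewrite xpair_eqE !prod_diag (eq_sym f') (eq_sym h') negb_and.
by case/orP=> /negPf ->; rewrite ?mul0r ?mulr0 ?mul0r.
Qed.

Lemma invmx_diag (C : numClosedFieldType) N (t : 'rV[C]_N) :
  \prod_i t 0 i = 1 ->
  invmx (diag_mx t) = diag_mx (\row_i (t 0 i)^-1).
Proof.
move=> t1; have tu : diag_mx t \in unitmx by rewrite unitmxE det_diag t1 unitr1.
have E : diag_mx t *m diag_mx (\row_i (t 0 i)^-1) = 1%:M.
  apply/matrixP=> i k; rewrite mulmx_diag !mxE; case: eqP => // _.
  rewrite mulfV // -unitfE; have: \prod_i t 0 i \is a GRing.unit by rewrite t1 unitr1.
  by rewrite (bigD1 i) //= unitrM => /andP[].
by rewrite -[LHS]mulmx1 -E mulKmx.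
Qed.

Lemma gmatP (C : numClosedFieldType) (n : nat)
    (j : forall m : 'I_n.+1, {linear 'cV[C]_n.+1 -> Vmod C m})
    (p : forall m : 'I_n.+1, {linear Vmod C m -> 'cV[C]_n.+1})
    (jH : forall m, H_equivariant (j m)) (pj : forall m, adjoint (j m) (p m))
    (t : 'rV[C]_n.+1) (t1 : \prod_i t 0 i = 1) (i m : 'I_n.+1) :
  p m (act (Aelt t) (j m (delta_mx i 0))) =
  gmat j p (Aelt t) i m *: delta_mx i 0.
Proof.
apply/colP=> k; rewrite mxE [gmat _ _ _ _ _]mxE [in RHS]mxE eqxx andbT.
have [->|ki] := eqVneq k i; first by rewrite mulr1.
rewrite mulr0 -dotV_delta pj /dotE big1 ?mulr0 // => -[f h] _.
rewrite /Aelt invmx_diag // act_diag.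
pose d : 'rV[C]_n.+1 := \row_l (if l == i then 2 else if l == k then 2^-1 else 1).
have two0 : (2 : C) != 0 by rewrite pnatr_eq0.
have dSL : diag_mx d \in SL.
  rewrite inE det_diag (bigD1 i) //= (bigD1 k) //= !mxE !eqxx (negPf ki).
  rewrite big1 ?mulr1 ?mulfV // => l /andP[/negPf li /negPf lk].
  by rewrite mxE li lk.
have Ed l : diag_mx d *m delta_mx l 0 = d 0 l *: (delta_mx l 0 : 'cV_n.+1).
  rewrite mul_diag_mx; apply/colP=> l'; rewrite !mxE.
  by case: (eqVneq l' l) => [->|_]; rewrite ?mulr0.
have W l : d 0 l * j m (delta_mx l 0) (f, h) =
    (\prod_x d 0 (f x)) * (\prod_y d 0 (h y)) * j m (delta_mx l 0) (f, h).
  rewrite -act_diag -(jH m _ dSL) Ed linearZ /=.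
  by rewrite [in RHS]/GRing.scale /= ffunE.
set w := _ * \prod_y d 0 (h y) in W.
have [->|ui] := eqVneq (j m (delta_mx i 0) (f, h)) 0.
  by rewrite mulr0 mul0r.
have [->|uk] := eqVneq (j m (delta_mx k 0) (f, h)) 0.
  by rewrite rmorph0 mulr0.
have := mulIf ui (W i); rewrite -(mulIf uk (W k)) !mxE !eqxx (negPf ki) => /eqP.
rewrite -(inj_eq (mulfI two0)) mulfV // -natrM.
by rewrite (eqr_nat _ 4 1).
Qed.

(* Main.v *)
(** Write T = j_m(e_1).  Equivariance under the diagonal torus, together with
    alternation, forces a coordinate T(f, h) to vanish unless f and h are
    injective with images J, K meeting exactly in {1}.  Monomial matrices of
    determinant one fixing e_1 permute these coordinates transitively up to
    sign, so they all have the same squared modulus c.  Hence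
    <(t, t^-1) T, T> is c times the sum of t^J / t^K, and t = 1 gives
    1 = c binom(n, m - 1) because j_m is isometric. *)
Require Import Defs.
From mathcomp Require Import all_boot all_order all_algebra all_fingroup.
From mathcomp Require Import complex reals.
Set Implicit Arguments.
Unset Strict Implicit.
Unset Printing Implicit Defensive.
Import Order.TTheory GRing.Theory Num.Theory.
Local Open Scope ring_scope.

(** * Finite combinatorics: injections, permutations, pairs of subsets *)

Lemma sum_injective_ffun (V : nmodType) (I J : finType) (F : {set J} -> V) :
  \sum_(f : {ffun I -> J} | injectiveb f) F (f @: I) =
  (\sum_(A : {set J} | #|A| == #|I|) F A) *+ #|I|`!.
Proof.
rewrite (partition_big (fun f : {ffun I -> J} => f @: I)
                       (fun A => #|A| == #|I|)) /=; last first.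
  by move=> f /injectiveP f_inj; rewrite card_imset.
rewrite -sumrMnl; apply: eq_bigr => A /eqP cardA.
rewrite (eq_bigr (fun=> F A)) => [|f /andP[_ /eqP->] //].
rewrite sumr_const -ffactnn -{1}cardA -card_inj_ffuns_on; congr (_ *+ _).
apply: eq_card => f; rewrite !inE andbC unfold_in.
case: injectiveP => [f_inj|] //=; rewrite eqEcard card_imset // cardA leqnn andbT.
apply/subsetP/forallP => [fA x | fA _ /imsetP[x _ ->] //].
exact/fA/imset_f.
Qed.

(** Composing [g'] with a section of [g] gives a self-map of [T]. It is injective because the
    kernels agree, hence a permutation. *)
Lemma perm_of_same_kernel (Z T : finType) (g g' : Z -> T) :
  (forall l, exists z, g z = l) ->
  (forall z z', (g z == g z') = (g' z == g' z')) ->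
  exists s : {perm T}, forall z, s (g z) = g' z.
Proof.
move=> /fin_all_exists[e ge] ker.
have s_inj : injective (g' \o e).
  by move=> l l' /eqP; rewrite /= -ker !ge => /eqP.
by exists (perm s_inj) => z; rewrite permE; apply/eqP; rewrite /= -ker ge.
Qed.

(** The sizes add up to [n.+2] and the sets share one point, so they cover everything. The pair is
    thus determined by [B], the set [J] without [ord0]: [K] is the complement of [B], and [B] is any
    [m]-subset of the [n] other indices. *)
Lemma card_pairs_meeting_at_point (n : nat) (m : 'I_n.+1) :
  #|[pred JK : {set 'I_n.+1} * {set 'I_n.+1} |
      [&& #|JK.1| == m.+1, #|JK.2| == (n.+2 - m.+1)%N
        & JK.1 :&: JK.2 == [set ord0]]]| = 'C(n, m).
Proof.
pose D := [set B : {set 'I_n.+1} | B \subset [set~ ord0] & #|B| == m].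
have <- : #|D| = 'C(n, m) by rewrite cards_draws cardsC1 card_ord.
have e_inj : injective (fun B : {set 'I_n.+1} => (ord0 |: B, ~: B)).
  by move=> B B' [_ /setC_inj].
rewrite -(card_imset _ e_inj); apply: eq_card => -[J K]; rewrite !inE /=.
apply/and3P/imsetP => [[/eqP cJ /eqP cK /eqP JK] | [B]].
  have J0 : ord0 \in J by have := set11 (@ord0 n); rewrite -JK inE => /andP[].
  have cB : #|J :\ ord0| = m by have := cardsD1 ord0 J; rewrite J0 cJ => -[].
  exists (J :\ ord0); first by rewrite inE cB eqxx subsetDr.
  rewrite setD1K //; congr (_, _); apply/eqP; rewrite eqEcard; apply/andP; split.
    apply/subsetP=> l Kl; have /setP/(_ l) := JK; rewrite !inE Kl andbT => ->.
    by rewrite andNb.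
  by rewrite cK -(leq_add2l #|J :\ ord0|) cardsC cB card_ord subSS subnKC // ltnW.
rewrite inE => /andP[sB /eqP cB] [-> ->].
have B0 : ord0 \notin B by apply/negP=> /(subsetP sB); rewrite !inE eqxx.
split; first by rewrite cardsU1 B0 cB.
  by rewrite -(eqn_add2l #|B|) cardsC cB card_ord subSS subnKC // ltnW.
by apply/eqP/setP=> l; rewrite !inE; have [->|_] := eqVneq l; rewrite ?B0 ?andbN.
Qed.

(** * Coordinates of bialternating tensors under monomial matrices *)

Section Coordinates.
Variables (C : numClosedFieldType) (N a b : nat).
Implicit Types (T : ext_pair C N a b).
Implicit Types (f : {ffun 'I_a -> 'I_N}) (h : {ffun 'I_b -> 'I_N}).

Lemma fcomp1 (I : finType) (f : {ffun I -> 'I_N}) : fcomp f 1%g = f.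
Proof. by apply/ffunP=> x; rewrite ffunE perm1. Qed.

Lemma ext_pair_perm T s r f h :
  T (fcomp f s, fcomp h r) = (-1) ^+ odd_perm s * (-1) ^+ odd_perm r * T (f, h).
Proof. by case: T => T /= /bialternatingP. Qed.

Lemma fcomp_tperm (I : finType) (f : {ffun I -> 'I_N}) x y :
  f x = f y -> fcomp f (tperm x y) = f.
Proof.
by move=> fxy; apply/ffunP=> z; rewrite ffunE; case: tpermP => // ->.
Qed.

Lemma eq_opp_eq0 (u : C) : u = - u -> u = 0.
Proof. by move=> /eqP; rewrite -addr_eq0 -mulr2n mulrn_eq0 => /eqP. Qed.

(** Swapping two slots that carry the same index fixes the coordinate yet changes its sign. *)
Lemma ext_pair_injective T f h :
  T (f, h) != 0 -> injectiveb f && injectiveb h.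
Proof.
apply: contraNT; rewrite negb_and; case/orP => /injectivePn[x [y xy fxy]].
  apply/eqP/eq_opp_eq0; rewrite -{1}(fcomp_tperm fxy) -{1}(fcomp1 h) ext_pair_perm.
  by rewrite odd_perm1 odd_tperm xy mulr1 expr1 mulN1r.
apply/eqP/eq_opp_eq0; rewrite -{1}(fcomp_tperm fxy) -{1}(fcomp1 f) ext_pair_perm.
by rewrite odd_perm1 odd_tperm xy mul1r expr1 mulN1r.
Qed.

(** The transpose makes the matrix send the basis vector at [k] to a multiple of the one at [s k],
    since [perm_mx s] has its ones at the places [(i, s i)]. *)
Definition monomial_mx (s : 'S_N) (e : 'rV[C]_N) : 'M[C]_N :=
  (perm_mx s)^T *m diag_mx e.

Lemma monomial_mxE s e i k :
  monomial_mx s e i k = e 0 k *+ (i == s k).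
Proof.
by rewrite /monomial_mx mul_mx_diag !mxE eq_sym; case: eqP; rewrite ?mul1r ?mul0r.
Qed.

Lemma det_monomial_mx s e :
  \det (monomial_mx s e) = (-1) ^+ odd_perm s * \prod_i e 0 i.
Proof. by rewrite det_mulmx det_tr det_perm det_diag. Qed.

Lemma monomial_mx_delta s e k :
  monomial_mx s e *m delta_mx k 0 = e 0 k *: delta_mx (s k) 0 :> 'cV_N.
Proof.
apply/colP=> i; rewrite -colE mxE monomial_mxE !mxE andbT.
by rewrite mulr_natr.
Qed.

Lemma prod_monomial_mx (I : finType) (f f' : {ffun I -> 'I_N}) s e :
  \prod_x monomial_mx s e ([ffun z => s (f z)] x) (f' x) =
  (\prod_x e 0 (f x)) *+ (f == f').
Proof.
rewrite -prod_diag; apply: eq_bigr => x _.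
by rewrite ffunE monomial_mxE mxE (inj_eq perm_inj); case: eqP => // ->.
Qed.

Lemma act_monomial_mx T s e f h :
  Defs.act (monomial_mx s e, monomial_mx s e) T
    ([ffun x => s (f x)], [ffun y => s (h y)]) =
  (\prod_x e 0 (f x)) * (\prod_y e 0 (h y)) * T (f, h).
Proof.
rewrite ffunE (bigD1 (f, h)) //= !prod_monomial_mx !eqxx.
rewrite [X in _ + X]big1 ?addr0 // => -[f' h'].
rewrite xpair_eqE !prod_monomial_mx (eq_sym f') (eq_sym h') negb_and.
by case/orP=> /negPf ->; rewrite ?mul0r ?mulr0 ?mul0r.
Qed.

End Coordinates.

(** * Tensors transforming like the first basis vector *)

Section WeightVector.
Variables (C : numClosedFieldType) (n a b : nat).
Implicit Types (f : {ffun 'I_a -> 'I_n.+1}) (h : {ffun 'I_b -> 'I_n.+1}).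
Hypotheses (n_gt0 : (0 < n)%N) (a_gt0 : (0 < a)%N) (b_gt0 : (0 < b)%N).
Hypothesis (abE : (a + b = n.+2)%N).
Local Notation e0 := (delta_mx ord0 0 : 'cV[C]_n.+1).

Variable T : ext_pair C n.+1 a b.
(** What equivariance and linearity of an embedding say about the image [T] of [e0]. Torus elements
    with [c] different from 1 constrain the support; monomial matrices with [c = 1] relate the
    coordinates. *)
Hypothesis T_weight : forall g, g \in SL -> forall c, g *m e0 = c *: e0 ->
  forall fh, Defs.act (g, g) T fh = c * T fh.

Definition meet_at_ord0 f h :=
  [&& injectiveb f, injectiveb h & f @: 'I_a :&: h @: 'I_b == [set ord0]].

Lemma prod_two_points (I : finType) (f : {ffun I -> 'I_n.+1}) (d : 'I_n.+1 -> C)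
    (i : 'I_n.+1) :
  injective f -> i != ord0 -> (forall l, l != i -> l != ord0 -> d l = 1) ->
  \prod_x d (f x) = d i ^+ (i \in f @: I) * d ord0 ^+ (ord0 \in f @: I).
Proof.
move=> f_inj i0 d1.
have -> : \prod_x d (f x) = \prod_(l in f @: I) d l.
  by rewrite big_imset //=; apply: in2W.
rewrite big_mkcond (bigD1 i) //= (bigD1 ord0) ?[ord0 == i]eq_sym //= big1 ?mulr1.
  by do 2?case: (_ \in _).
by move=> l /andP[li l0]; rewrite d1 // if_same.
Qed.

(** The torus element with entries 2 at [i] and 1/2 at [ord0] scales [e0] by 1/2. Comparing powers
    of 2 yields [count]. As [J] and [K] are nonempty, both must contain [ord0], and then every other
    [i] lies in exactly one of them. *)
Lemma support_meets_at_ord0 f h : T (f, h) != 0 -> meet_at_ord0 f h.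
Proof.
move=> Tfh; have /andP[f_injb h_injb] := ext_pair_injective Tfh.
rewrite /meet_at_ord0 f_injb h_injb /=.
move/injectiveP: f_injb => f_inj; move/injectiveP: h_injb => h_inj.
set J := f @: _; set K := h @: _.
have two0 : (2 : C) != 0 by rewrite pnatr_eq0.
have count i : i != ord0 ->
    ((i \in J) + (i \in K)).+1 = ((ord0 \in J) + (ord0 \in K))%N.
  move=> i0.
  pose d : 'rV[C]_n.+1 := \row_l (if l == i then 2 else if l == ord0 then 2^-1 else 1).
  have di : d 0 i = 2 by rewrite mxE eqxx.
  have d0 : d 0 ord0 = 2^-1 by rewrite mxE eq_sym (negPf i0) eqxx.
  have d1 l : l != i -> l != ord0 -> d 0 l = 1.
    by rewrite mxE => /negPf-> /negPf->.
  have dSL : diag_mx d \in SL.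
    rewrite inE det_diag (bigD1 i) //= (bigD1 ord0) ?[ord0 == i]eq_sym //=.
    by rewrite di d0 big1 ?mulr1 ?mulfV // => l /andP[]; apply: d1.
  have Ed : diag_mx d *m e0 = 2^-1 *: e0.
    rewrite mul_diag_mx; apply/colP=> l; rewrite !mxE.
    by have [->|_] := eqVneq l ord0; rewrite ?mulr0 // eq_sym (negPf i0).
  have := T_weight dSL Ed (f, h); rewrite act_diag => /(mulIf Tfh).
  rewrite !(prod_two_points (i := i)) // di d0 !exprVn -/J -/K => /eqP.
  rewrite mulrACA -exprD -invfM -exprD => /eqP E.
  apply/eqP; rewrite -(eqn_exp2l _ _ (ltnSn 1)) -(eqr_nat C) !natrX.
  rewrite exprS; have p0 k : (2 : C) ^+ k != 0 by rewrite expf_neq0.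
  set k0 := ((ord0 \in J) + (ord0 \in K))%N.
  move/(congr1 (fun u => 2 * u * 2 ^+ k0)): E.
  by rewrite mulfV // mul1r -!mulrA mulVf // mulr1 => <-.
(* An element of [A] other than [ord0] makes the left side at least 2, which forces both memberships
   on the right. *)
have mem0 (A B : {set 'I_n.+1}) : A != set0 ->
    (forall i, i != ord0 ->
      ((i \in A) + (i \in B)).+1 = ((ord0 \in A) + (ord0 \in B))%N) ->
    ord0 \in A.
  case/set0Pn=> l Al E; have [<-//|/E] := eqVneq l ord0.
  by rewrite Al; case: (ord0 \in A); case: (ord0 \in B); case: (_ \in B).
have J0 : ord0 \in J.
  by apply: mem0 count; apply/set0Pn; exists (f (Ordinal a_gt0)); apply: imset_f.
have K0 : ord0 \in K.
  apply: (mem0 _ J) => [|i /count]; last by rewrite addnC => ->; rewrite addnC.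
  by apply/set0Pn; exists (h (Ordinal b_gt0)); apply: imset_f.
apply/eqP/setP=> l; rewrite !inE; have [->|/count] := eqVneq l ord0.
  by rewrite J0 K0.
by rewrite J0 K0; do 2!case: (_ \in _).
Qed.

(* A determinant one lift of [s] fixing [e0] exists because the sign of [s] can
   be absorbed by another basis vector. *)
Lemma norm_perm_fixing0 (s : 'S_n.+1) f h : s ord0 = ord0 ->
  `|T ([ffun x => s (f x)], [ffun y => s (h y)])| = `|T (f, h)|.
Proof.
move=> s0.
pose e : 'rV[C]_n.+1 := \row_l (if l == ord_max then (-1) ^+ odd_perm s else 1).
(* Here [n_gt0] supplies a basis vector other than [e0] to carry the sign. *)
have max0 : (ord_max : 'I_n.+1) != ord0 by rewrite -val_eqE /= -lt0n.
have e_0 : e 0 ord0 = 1 by rewrite mxE eq_sym (negPf max0).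
have eSL : monomial_mx s e \in SL.
  rewrite inE det_monomial_mx (bigD1 ord_max) //= mxE eqxx big1.
    by rewrite mulr1 -expr2 sqrr_sign.
  by move=> l /negPf lm; rewrite mxE lm.
have Ee : monomial_mx s e *m e0 = 1 *: e0 by rewrite monomial_mx_delta s0 e_0.
have ne l : `|e 0 l| = 1 by rewrite mxE; case: ifP; rewrite ?normr_sign ?normr1.
rewrite -[T _]mul1r -(T_weight eSL Ee) act_monomial_mx !normrM !normr_prod.
by rewrite !big1 ?mul1r.
Qed.

Lemma norm_fcomp (s : 'S_a) (r : 'S_b) f h :
  `|T (fcomp f s, fcomp h r)| = `|T (f, h)|.
Proof. by rewrite ext_pair_perm !normrM !normr_sign !mul1r. Qed.

Lemma meet_at_ord0_cover f h : meet_at_ord0 f h -> f @: 'I_a :|: h @: 'I_b = setT.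
Proof.
case/and3P=> /injectiveP f_inj /injectiveP h_inj /eqP fh0.
apply/eqP; rewrite eqEcard subsetT cardsT card_ord cardsU fh0 !card_imset //.
by rewrite !card_ord abE cards1 subn1 /=.
Qed.

(** Once the slots are reordered so that both pairs take the value [ord0] at the same places, their
    joint maps on ['I_a + 'I_b] have the same coincidences, so a permutation of the indices carries
    one to the other. *)
Lemma norm_meet_at_ord0 f h f' h' : meet_at_ord0 f h -> meet_at_ord0 f' h' ->
  `|T (f, h)| = `|T (f', h')|.
Proof.
have zeros u v : meet_at_ord0 u v -> exists x y, u x = ord0 /\ v y = ord0.
  case/and3P=> _ _ /eqP/setP/(_ ord0); rewrite !inE eqxx.
  by case/andP=> /imsetP[x _ ux] /imsetP[y _ vy]; exists x, y.
move=> fh fh'; have [x [y [fx hy]]] := zeros _ _ fh.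
have [x' [y' [fx' hy']]] := zeros _ _ fh'.
rewrite -(norm_fcomp (tperm x x') (tperm y y') f h).
(* The only coincidence between a value of [u] and a value of [v] is the common value [ord0]. *)
have ker u v z w i k : meet_at_ord0 u v -> u z = ord0 -> v w = ord0 ->
    (u i == v k) = (i == z) && (k == w).
  case/and3P=> /injectiveP u_inj /injectiveP v_inj /eqP/setP uv uz vw.
  rewrite -(inj_eq u_inj) -(inj_eq v_inj) uz vw.
  apply/eqP/andP => [E | [/eqP-> /eqP->]//].
  have := uv (u i); rewrite !inE {2}E !imset_f //= => /esym/eqP ui.
  by rewrite -E ui.
pose g (z : 'I_a + 'I_b) := match z with
  inl i => f (tperm x x' i) | inr k => h (tperm y y' k) end.
pose g' (z : 'I_a + 'I_b) := match z with inl i => f' i | inr k => h' k end.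
have g_surj l : exists z, g z = l.
  have : l \in f @: 'I_a :|: h @: 'I_b by rewrite meet_at_ord0_cover // inE.
  rewrite inE; case/orP => /imsetP[i _ ->].
    by exists (inl (tperm x x' i)); rewrite /g tpermK.
  by exists (inr (tperm y y' i)); rewrite /g tpermK.
have cross i k : (f (tperm x x' i) == h (tperm y y' k)) = (f' i == h' k).
  rewrite (ker _ _ _ _ _ _ fh fx hy) (ker _ _ _ _ _ _ fh' fx' hy').
  by rewrite -{2}(tpermR x x') -{2}(tpermR y y') !(inj_eq perm_inj).
have [s sg] : exists s : 'S_n.+1, forall z, s (g z) = g' z.
  case/and3P: fh => /injectiveP f_inj /injectiveP h_inj _.
  case/and3P: fh' => /injectiveP f'_inj /injectiveP h'_inj _.
  apply: perm_of_same_kernel g_surj _ => -[i|k] [i'|k'] //=.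
  - by rewrite !(inj_eq f_inj, inj_eq f'_inj, inj_eq perm_inj).
  - by rewrite eq_sym cross eq_sym.
  - by rewrite !(inj_eq h_inj, inj_eq h'_inj, inj_eq perm_inj).
(* [s] fixes [ord0] because [g] and [g'] both send [inl x'] to it. *)
rewrite -[LHS](norm_perm_fixing0 (s := s)); last first.
  by have := sg (inl x'); rewrite /= tpermR fx fx'.
by congr (`| T (_, _) |); apply/ffunP=> z; rewrite !ffunE;
  [have := sg (inl z) | have := sg (inr z)].
Qed.

Lemma sqnorm_weight_vector :
  exists c : C, forall f h, T (f, h) * (T (f, h))^* = c *+ meet_at_ord0 f h.
Proof.
case: (pickP (fun fh => meet_at_ord0 fh.1 fh.2)) => [[f0 h0] /= fh0 | none].
  exists (`|T (f0, h0)| ^+ 2) => f h; rewrite -normCK.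
  have [fh|nfh] := boolP (meet_at_ord0 f h).
    by rewrite (norm_meet_at_ord0 fh fh0).
  have [->|Tfh] := eqVneq (T (f, h)) 0; first by rewrite normr0 expr0n.
  by rewrite support_meets_at_ord0 in nfh.
(* With no pair meeting at [ord0] all coordinates vanish, so any constant would do. *)
exists 0 => f h; rewrite mul0rn; apply/eqP; rewrite -normCK expf_eq0 /= normr_eq0.
by apply: contraFT (none (f, h)); apply: support_meets_at_ord0.
Qed.

(** A diagonal pair scales each coordinate by a product depending only on the images of [f] and [h],
    so the sum can be grouped by these images. *)
Lemma dotE_diag_weight_vector : exists c : C, forall u v : 'rV[C]_n.+1,
  dotE (Defs.act (diag_mx u, diag_mx v) T) T =
  c * \sum_(JK : {set 'I_n.+1} * {set 'I_n.+1} |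
            [&& #|JK.1| == a, #|JK.2| == b & JK.1 :&: JK.2 == [set ord0]])
        (\prod_(x in JK.1) u 0 x) * (\prod_(y in JK.2) v 0 y).
Proof.
have [c Tc] := sqnorm_weight_vector; exists c => u v.
(* Recording the intersection condition as a multiplicity lets [f] and [h] range independently over
   injections. *)
pose F (J K : {set 'I_n.+1}) := ((\prod_(x in J) u 0 x) * (\prod_(y in K) v 0 y))
  *+ (J :&: K == [set ord0]).
have -> : dotE (Defs.act (diag_mx u, diag_mx v) T) T = (a`! * b`!)%:R^-1 * (c *
    \sum_(f : {ffun 'I_a -> 'I_n.+1} | injectiveb f)
          \sum_(h : {ffun 'I_b -> 'I_n.+1} | injectiveb h) F (f @: 'I_a) (h @: 'I_b)).
  apply: (congr1 (fun w : C => (a`! * b`!)%:R^-1 * w)).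
  rewrite pair_big [in RHS]big_mkcond mulr_sumr; apply: eq_bigr => -[f h] _ /=.
  have TcM (w : C) : w * T (f, h) * (T (f, h))^* = w * (c *+ meet_at_ord0 f h).
    by rewrite -mulrA Tc.
  rewrite act_diag; apply: etrans (TcM _) _; rewrite /meet_at_ord0.
  case: injectiveP => [f_inj|_]; last by rewrite /= mulr0 mulr0.
  case: injectiveP => [h_inj|_]; last by rewrite /= mulr0 mulr0.
  rewrite /F !big_imset /=; do 2?exact: in2W.
  by rewrite mulrnAr mulrnAr mulrC.
under eq_bigr => f _ do rewrite (sum_injective_ffun _ (F (f @: 'I_a))) card_ord.
rewrite sumrMnl (sum_injective_ffun _ (fun J => \sum_(K : {set _} | #|K| == b) F J K)).
rewrite card_ord -mulrnA mulrnAr -(mulr_natl (c * _)) mulKf; last first.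
  by rewrite pnatr_eq0 -lt0n muln_gt0 !fact_gt0.
congr (c * _); rewrite pair_big big_mkcond [RHS]big_mkcond.
apply: eq_bigr => -[J K] _ /=; by rewrite /F; do 3!case: (_ == _).
Qed.

End WeightVector.

Theorem theorem6p14 (R : realType) (n : nat) (n_ge1 : (1 <= n)%N)
    (j : forall m : 'I_n.+1, {linear 'cV[R[i]]_n.+1 -> Vmod R[i] m})
    (p : forall m : 'I_n.+1, {linear Vmod R[i] m -> 'cV[R[i]]_n.+1})
    (j_isometric : forall m : 'I_n.+1, isometric (j m))
    (j_equivariant : forall m : 'I_n.+1, H_equivariant (j m))
    (p_adjoint : forall m : 'I_n.+1, adjoint (j m) (p m))
    (t : 'rV[R[i]]_n.+1) (t_SL : \prod_i t ord0 i = 1) (m : 'I_n.+1) :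
  gmat (fun k => j k) (fun k => p k) (Aelt t) ord0 m =
    ('C(n, m)%:R)^-1 *
    \sum_(JK : {set 'I_n.+1} * {set 'I_n.+1} |
            [&& #|JK.1| == m.+1, #|JK.2| == (n.+2 - m.+1)%N
              & JK.1 :&: JK.2 == [set ord0]])
       ((\prod_(x in JK.1) t ord0 x) / (\prod_(y in JK.2) t ord0 y)).
Proof.
have b_gt0 : (0 < n.+2 - m.+1)%N by rewrite subn_gt0 ltnS ltn_ord.
have abE : (m.+1 + (n.+2 - m.+1) = n.+2)%N by rewrite subnKC // leqW.
have T_weight g : g \in SL -> forall c,
    g *m delta_mx ord0 0 = c *: (delta_mx ord0 0 : 'cV[R[i]]_n.+1) ->
    forall fh, Defs.act (g, g) (j m (delta_mx ord0 0)) fh =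
      c * j m (delta_mx ord0 0) fh.
  move=> gSL c gc fh; rewrite -(j_equivariant m g gSL) gc linearZ /=.
  by rewrite [in LHS]/GRing.scale /= ffunE.
have [c Ec] := dotE_diag_weight_vector n_ge1 (ltn0Sn m) b_gt0 abE T_weight.
(* The identity of the torus turns each summand into 1 and the left side into the squared norm of
   the image of a unit vector. *)
have cE : c = ('C(n, m)%:R)^-1.
  have := Ec (const_mx 1) (const_mx 1); rewrite !diag_const_mx.
  (* Equivariance under the identity matrix avoids a computation in coordinates. *)
  have -> : Defs.act (1%:M, 1%:M) (j m (delta_mx ord0 0)) = j m (delta_mx ord0 0).
    by rewrite -j_equivariant ?mul1mx // inE det1.
  rewrite j_isometric dotV_delta mxE !eqxx (eq_bigr (fun=> 1)); last first.
    by move=> JK _; rewrite !big1 ?mulr1 // => x _; rewrite mxE.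
  rewrite sumr_const card_pairs_meeting_at_point => E.
  have bin0 : 'C(n, m)%:R != 0 :> R[i] by rewrite pnatr_eq0 -lt0n bin_gt0 -ltnS.
  by apply: (mulIf bin0); rewrite -E mulVf.
(* The diagonal entry is an inner product with the first basis vector; adjointness moves it into the
   exterior pair. *)
rewrite mxE -dotV_delta p_adjoint /Aelt invmx_diag // Ec cE; congr (_ * _).
apply: eq_bigr => JK _; rewrite -prodfV; congr (_ * _).
by apply: eq_bigr => y _; rewrite mxE.
Qed.
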